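(* Let $A_1A_2A_3$ be an isosceles triangle in $\mathbb{R}^2$ with $A_1A_2=A_1A_3=a$, let $w_1=w_2=w_3=1$, let $A_4$ be the midpoint of $A_2A_3$, put $\phi(0)=\angle A_4A_1A_3$, and assume $\phi(0)<60^\circ$. Let $O$ be the (unweighted) Fermat-Torricelli point of $\triangle A_1A_2A_3$. Consider a knot of mass $m_0>0$ pulled without friction towards $A_1,A_2,A_3$ by forces of constant magnitude $1$, released from $A_1$ at time $0$ with zero velocity, and let $x(t)$ be the distance from $A_1$ to the knot at time $t$. Then, at the time $t_0$ at which the knot first passes through $O$, its velocity is $$\dot{x}(t_0)=\sqrt{\frac{2}{m_0}\left(2a-x(t_0)-\frac{4a\sin\phi(0)}{\sqrt{3}}\right)}.$$
   Context: The Fermat-Torricelli point of $\triangle A_1A_2A_3$ is the unique point $O\in\mathbb{R}^2$ minimizing $P\mapsto\sum_{i=1}^3|PA_i|$. For $\phi(0)<60^\circ$ it lies on the height $A_1A_4$ with $O\ne A_1$. Mechanical system: three holes are drilled in a horizontal board at $A_1,A_2,A_3$; three strings tied together in a knot of mass $m_0$ pass through the holes, with physical weights $w_1,w_2,w_3$ (here all equal to $1$) attached to their loose ends. Friction is neglected, and the string through $A_i$ exerts on the knot a force of constant magnitude $w_i$ directed towards $A_i$. Released from $A_1$, the knot moves along the line $A_1O$; when it is at position $S$ at distance $x$ from $A_1$, its equation of motion is $m_0\ddot x=2\cos\phi-1$, where $\phi$ is the angle at $S$ between the direction from $A_1$ to $O$ and the ray $SA_3$, with $x(0)=0$, $\dot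 x(0)=0$. *)

(* Defs.v *)
From Stdlib Require Import Reals.
From Coquelicot Require Import Coquelicot.
Open Scope R_scope.

(* Coquelicot's norm on a product of normed modules is
   sqrt (norm x ^ 2 + norm y ^ 2), so on R * R it is the Euclidean norm. *)
Notation plane := (prod_NormedModule R_AbsRing R_NormedModule R_NormedModule).

Definition distance (A B : plane) : R := norm (minus B A).

Definition dot (u v : plane) : R := fst u * fst v + snd u * snd v.

(* The unoriented angle ABC at the vertex B, in [0, PI]; meaningful when A and C
   are distinct from B. *)
Definition angle (A B C : plane) : R :=
  acos (dot (minus A B) (minus C B) / (distance B A * distance B C)).

Definition midpoint (A B : plane) : plane := scal (1 / 2) (plus A B).

Definition is_triangle (A B C : plane) : Prop :=
  fst (minus B A) * snd (minus C A) - snd (minus B A) * fst (minus C A) <> 0.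

(* For distinct A and B. *)
Definition on_line (A B S : plane) : Prop :=
  exists k : R, S = plus A (scal k (minus B A)).

Definition sum_of_distances (A1 A2 A3 S : plane) : R :=
  distance S A1 + distance S A2 + distance S A3.

(* Uniqueness of the minimizer is not built in. *)
Definition fermat_torricelli (A1 A2 A3 O : plane) : Prop :=
  forall S : plane, sum_of_distances A1 A2 A3 O <= sum_of_distances A1 A2 A3 S.

(* F is a force of magnitude w at S, directed towards A.  When S = A the
   direction is indeterminate and any force of magnitude w is admitted. *)
Definition pulls_towards (w : R) (A S F : plane) : Prop :=
  norm F = w /\ exists k : R, 0 <= k /\ minus A S = scal k F.

(* Trajectory P (for times t >= 0) of a knot of mass m0 released from A1 at time
   0 with zero velocity, and pulled towards A1, A2, A3 by forces of magnitudes
   w1, w2, w3; v is its velocity at positive times.  The initial velocity is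
   the right derivative, as values of P at negative times carry no meaning. *)
Record knot_motion (m0 w1 w2 w3 : R) (A1 A2 A3 : plane) (P v : R -> plane)
  : Prop := {
  knot_start : P 0 = A1;
  knot_at_rest :
    filterlim (fun t : R => scal (/ t) (minus (P t) (P 0)))
      (at_right 0) (locally (zero : plane));
  knot_velocity : forall t : R, 0 < t -> is_derive P t (v t);
  knot_newton : forall t : R, 0 < t ->
    exists F1 F2 F3 acc : plane,
      pulls_towards w1 A1 (P t) F1 /\
      pulls_towards w2 A2 (P t) F2 /\
      pulls_towards w3 A3 (P t) F3 /\
      is_derive v t acc /\
      scal m0 acc = plus (plus F1 F2) F3
}.

Definition first_passage (P : R -> plane) (S : plane) (t0 : R) : Prop :=
  0 <= t0 /\ P t0 = S /\ forall t : R, 0 <= t < t0 -> P t <> S.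

(* Main.v *)
Require Import Defs.
From Stdlib Require Import Reals Ranalysis5 Lra.
From Coquelicot Require Import Coquelicot.
Open Scope R_scope.

(** Why the formula holds.  Put an orthonormal frame at [A1], with [e] along the
    height and [n] along the base, so that [A2] and [A3] have coordinates [(h, -b)]
    and [(h, b)], where [a ^ 2 = h ^ 2 + b ^ 2] and [b = a * sin phi0]
    ([isosceles_frame], [isosceles_half_apex]).

    The point [T] of the height at distance [d = h - b / sqrt 3] from [A1] sees the
    three vertices at mutual angles of 120 degrees, so the unit vectors from [T] to
    the vertices add up to zero.  Projecting on these vectors shows that [T] is the
    only minimizer of the sum of distances ([fermat_torricelli_isosceles]); the
    assumption [phi0 < PI / 3] says that [0 < d].

    The knot thus moves along the height, and its coordinate [s] solves a scalar
    equation.  Where [0 < s] the resultant of the three strings is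
    [axial_force h b s = 2 * cos phi - 1], with antiderivative [axial_work h b s],
    minus the total length of the three strings, and conservation of energy gives
    [s' ^ 2 / 2 = (axial_work d - axial_work 0) / m0] at the first passage through
    [s = d].  Since the two slanted strings have length [a] at the start and
    [2 * b / sqrt 3] at the end, this is the claimed value.

    Two points need care.  At [s = 0] the force of the string through [A1] is
    indeterminate, and for [s < 0] the distance to [A1] is not [s].  But whatever
    that string does, it pulls back with force at most [1], so the acceleration is
    positive as long as [s < d] ([axial_acceleration], [axial_force_gt_0]); hence
    the speed increases from [0], and [s] is positive at all times up to the
    passage.  Moreover the velocity is only known at positive times, together with
    the one-sided derivative of [s] at time [0]; monotonicity of the velocity
    turns the latter into the limit of the velocity at [0], which provides the
    initial value of the energy ([speed_of_rectilinear_motion_from_rest]). *)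

(** * Euclidean plane *)

Lemma plane_eq (u v : plane) : fst u = fst v -> snd u = snd v -> u = v.
Proof. intros; apply injective_projections; assumption. Qed.

Ltac plane_coords :=
  unfold dot in *;
  repeat (progress (unfold minus, plus, opp, scal, mult in *; simpl in * )).

Lemma dot_comm (u v : plane) : dot u v = dot v u.
Proof. unfold dot; ring. Qed.

Lemma dot_plus_l (u v w : plane) : dot (plus u v) w = dot u w + dot v w.
Proof. plane_coords; ring. Qed.

Lemma dot_minus_l (u v w : plane) : dot (minus u v) w = dot u w - dot v w.
Proof. plane_coords; ring. Qed.

Lemma dot_scal_l (k : R) (u w : plane) : dot (scal k u) w = k * dot u w.
Proof. plane_coords; ring. Qed.

Lemma norm_dot (u : plane) : norm u = sqrt (dot u u).
Proof.
  destruct u as [x y]. unfold dot; simpl.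
  change (norm ((x, y) : plane)) with (sqrt (Rabs x ^ 2 + Rabs y ^ 2)).
  rewrite !pow2_abs. f_equal. ring.
Qed.

Lemma dot_self_ge_0 (u : plane) : 0 <= dot u u.
Proof. unfold dot. nra. Qed.

Lemma dot_norm (u : plane) : dot u u = norm u * norm u.
Proof. rewrite norm_dot. symmetry. apply sqrt_sqrt, dot_self_ge_0. Qed.

Lemma norm_of_dot (u : plane) (r : R) : 0 <= r -> dot u u = r * r -> norm u = r.
Proof. intros Hr H. rewrite norm_dot, H. apply sqrt_square, Hr. Qed.

Lemma dot_unit (u : plane) : norm u = 1 -> dot u u = 1.
Proof. intros Hu. rewrite dot_norm, Hu. ring. Qed.

(** The residual of the orthogonal projection of [X] on the line of [u] has
    nonnegative square. *)
Lemma dot_le_norm (u X : plane) : norm u = 1 -> dot X u <= norm X.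
Proof.
  intros Hu. pose proof (norm_ge_0 X) as HX.
  pose proof (dot_self_ge_0 (minus X (scal (dot X u) u))) as H.
  pose proof (dot_unit u Hu) as Huu.
  pose proof (dot_norm X) as HXX.
  assert (E : dot (minus X (scal (dot X u) u)) (minus X (scal (dot X u) u))
              = dot X X - dot X u * dot X u * (2 - dot u u)).
  { plane_coords; ring. }
  rewrite E, Huu, HXX in H. nra.
Qed.

(** Equality case of Cauchy-Schwarz: [X - norm X * u] has square zero. *)
Lemma dot_eq_norm (u X : plane) :
  norm u = 1 -> dot X u = norm X -> X = scal (norm X) u.
Proof.
  intros Hu HE.
  pose proof (dot_unit u Hu) as Huu.
  pose proof (dot_norm X) as HXX.
  assert (E : dot (minus X (scal (norm X) u)) (minus X (scal (norm X) u)) = 0).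
  { transitivity (dot X X - 2 * norm X * dot X u + norm X * norm X * dot u u).
    - plane_coords; ring.
    - rewrite HE, Huu, HXX; ring. }
  assert (Hz : forall v : plane, dot v v = 0 -> fst v = 0 /\ snd v = 0).
  { intros v Hv. unfold dot in Hv. split; nra. }
  destruct (Hz _ E) as [H1 H2].
  apply plane_eq; plane_coords; lra.
Qed.

Lemma norm_scal_unit (k : R) (u : plane) : 0 <= k -> norm u = 1 -> norm (scal k u) = k.
Proof.
  intros Hk Hu. apply norm_of_dot; [ assumption | ].
  rewrite dot_scal_l, dot_comm, dot_scal_l, dot_norm, Hu. ring.
Qed.

Lemma dot_orthonormal_comb (e n : plane) (y c : R) :
  norm e = 1 -> norm n = 1 -> dot e n = 0 ->
  dot (plus (scal y e) (scal c n)) (plus (scal y e) (scal c n)) = y * y + c * c.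
Proof.
  intros He Hn Hen.
  transitivity (y * y * dot e e + c * c * dot n n + 2 * y * c * dot e n).
  - plane_coords; ring.
  - rewrite (dot_unit e He), (dot_unit n Hn), Hen. ring.
Qed.

(** Boundedness, part of being linear here, is Cauchy-Schwarz in the form of
    Lagrange's identity.  Projecting on a fixed vector therefore commutes with
    limits and derivatives, which reduces motion in the plane to scalar motion. *)
Lemma is_linear_dot (e : plane) : is_linear (fun X : plane => dot X e).
Proof.
  split.
  - intros; apply dot_plus_l.
  - intros; apply dot_scal_l.
  - exists (norm e + 1). pose proof (norm_ge_0 e) as He.
    split. { lra. }
    intros X. pose proof (norm_ge_0 X) as HX.
    change (norm (dot X e)) with (Rabs (dot X e)).
    assert (Hsq : Rsqr (dot X e) <= Rsqr (norm X * norm e)).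
    { unfold Rsqr.
      replace (norm X * norm e * (norm X * norm e))
        with (norm X * norm X * (norm e * norm e)) by ring.
      rewrite <- !dot_norm. unfold dot.
      assert (H := Rle_0_sqr (fst X * snd e - snd X * fst e)).
      unfold Rsqr in H. lra. }
    apply Rsqr_le_abs_0 in Hsq.
    rewrite (Rabs_pos_eq (norm X * norm e)) in Hsq; [ nra | ].
    apply Rmult_le_pos; assumption.
Qed.

Lemma is_derive_dot (f : R -> plane) (t : R) (l e : plane) :
  is_derive f t l -> is_derive (fun t => dot (f t) e) t (dot l e).
Proof.
  intros H. unfold is_derive in *.
  eapply filterdiff_ext_lin.
  - apply (filterdiff_comp' f (fun X : plane => dot X e) t
             (fun y => scal y l) (fun X : plane => dot X e) H).
    apply filterdiff_linear, is_linear_dot.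
  - intros y; simpl. apply dot_scal_l.
Qed.

(** * Fermat-Torricelli point of an isosceles triangle *)

(** The vectors [H] from [A1] to the midpoint of the base and [N] along half the
    base satisfy [A2 - A1 = H - N] and [A3 - A1 = H + N]; equality of the legs is
    the orthogonality of [H] and [N], and nondegeneracy makes both nonzero. *)
Lemma isosceles_frame (A1 A2 A3 : plane) :
  is_triangle A1 A2 A3 -> distance A1 A2 = distance A1 A3 ->
  exists (e n : plane) (h b : R),
    0 < h /\ 0 < b /\ norm e = 1 /\ norm n = 1 /\ dot e n = 0 /\
    minus A2 A1 = plus (scal h e) (scal (- b) n) /\
    minus A3 A1 = plus (scal h e) (scal b n) /\
    minus (midpoint A2 A3) A1 = scal h e.
Proof.
  intros Htri Hiso.
  set (H := minus (midpoint A2 A3) A1). set (N := minus A3 (midpoint A2 A3)).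
  assert (E2 : minus A2 A1 = minus H N).
  { unfold H, N, midpoint. apply plane_eq; plane_coords; field. }
  assert (E3 : minus A3 A1 = plus H N).
  { unfold H, N, midpoint. apply plane_eq; plane_coords; field. }
  assert (HN : dot H N = 0).
  { assert (E : dot (minus A2 A1) (minus A2 A1) = dot (minus A3 A1) (minus A3 A1)).
    { unfold distance in Hiso. rewrite !dot_norm, Hiso; ring. }
    rewrite E2, E3 in E. plane_coords; lra. }
  assert (Hnz : fst H * snd N - snd H * fst N <> 0).
  { intros C. apply Htri. rewrite E2, E3. plane_coords; lra. }
  clearbody H N.
  pose proof (norm_ge_0 H) as H0. pose proof (norm_ge_0 N) as N0.
  pose proof (dot_norm H) as HH. pose proof (dot_norm N) as NN.
  assert (Hh : 0 < norm H).
  { destruct H0 as [ | C]; [ assumption | exfalso; apply Hnz ].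
    rewrite <- C in HH. unfold dot in HH.
    assert (fst H = 0) as -> by nra. assert (snd H = 0) as -> by nra. ring. }
  assert (Hb : 0 < norm N).
  { destruct N0 as [ | C]; [ assumption | exfalso; apply Hnz ].
    rewrite <- C in NN. unfold dot in NN.
    assert (fst N = 0) as -> by nra. assert (snd N = 0) as -> by nra. ring. }
  assert (Hscal : forall X : plane, 0 < norm X -> scal (norm X) (scal (/ norm X) X) = X).
  { intros X HX. apply plane_eq; plane_coords; field; lra. }
  assert (Hunit : forall X : plane, 0 < norm X -> norm (scal (/ norm X) X) = 1).
  { intros X HX. apply norm_of_dot; [ lra | ].
    rewrite dot_scal_l, dot_comm, dot_scal_l, dot_norm. field; lra. }
  exists (scal (/ norm H) H), (scal (/ norm N) N), (norm H), (norm N).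
  rewrite !Hscal by assumption.
  repeat split; try assumption; try (apply Hunit; assumption).
  - rewrite dot_scal_l, dot_comm, dot_scal_l, dot_comm, HN. ring.
  - rewrite E2, <- (Hscal N Hb) at 1. apply plane_eq; plane_coords; ring.
Qed.

(** With [u1], [u2], [u3] the unit vectors from [T] towards the vertices, the sum
    of distances from any [O] is at least the sum of the projections of [Ai - O]
    on [ui], which equals the sum of distances from [T].  If [O] is a minimizer
    then each inequality is an equality, so that [O] lies on the ray from [Ai]
    opposite to [ui]; two of these rays meet only at [T]. *)
Lemma fermat_torricelli_isosceles (A1 A2 A3 O e n : plane) (h b : R) :
  0 < b -> b / sqrt 3 <= h -> norm e = 1 -> norm n = 1 -> dot e n = 0 ->
  minus A2 A1 = plus (scal h e) (scal (- b) n) ->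
  minus A3 A1 = plus (scal h e) (scal b n) ->
  fermat_torricelli A1 A2 A3 O ->
  minus O A1 = scal (h - b / sqrt 3) e.
Proof.
  intros Hb Hd He Hn Hen E2 E3 HO.
  pose proof (dot_unit e He) as Hee. pose proof (dot_unit n Hn) as Hnn.
  assert (H3 : 0 < sqrt 3) by (apply sqrt_lt_R0; lra).
  assert (S3 : sqrt 3 * sqrt 3 = 3) by (apply sqrt_sqrt; lra).
  set (r := b / sqrt 3) in *.
  assert (Hr : b = sqrt 3 * r) by (unfold r; field; lra).
  assert (Hr0 : 0 < r) by (unfold r; apply Rdiv_lt_0_compat; assumption).
  set (q := sqrt 3 / 2).
  assert (Hq : q * q = 3 / 4) by (unfold q; lra).
  assert (Hbq : b = 2 * q * r) by (unfold q; rewrite Hr; field).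
  set (u1 := scal (-1) e).
  set (u2 := plus (scal (1 / 2) e) (scal (- q) n)).
  set (u3 := plus (scal (1 / 2) e) (scal q n)).
  set (T := plus A1 (scal (h - r) e)).
  assert (Hu1 : norm u1 = 1).
  { apply norm_of_dot; [ lra | ]. unfold u1.
    transitivity (dot e e); [ plane_coords; ring | lra ]. }
  assert (Hu2 : norm u2 = 1).
  { apply norm_of_dot; [ lra | ]. unfold u2.
    rewrite dot_orthonormal_comb by assumption. lra. }
  assert (Hu3 : norm u3 = 1).
  { apply norm_of_dot; [ lra | ]. unfold u3.
    rewrite dot_orthonormal_comb by assumption. lra. }
  assert (T1 : minus A1 T = scal (h - r) u1).
  { unfold T, u1. apply plane_eq; plane_coords; ring. }
  assert (T2 : minus A2 T = scal (2 * r) u2).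
  { transitivity (minus (minus A2 A1) (minus T A1)).
    { apply plane_eq; plane_coords; ring. }
    rewrite E2, Hbq. unfold T, u2. apply plane_eq; plane_coords; field. }
  assert (T3 : minus A3 T = scal (2 * r) u3).
  { transitivity (minus (minus A3 A1) (minus T A1)).
    { apply plane_eq; plane_coords; ring. }
    rewrite E3, Hbq. unfold T, u3. apply plane_eq; plane_coords; field. }
  specialize (HO T). unfold sum_of_distances, distance in HO.
  rewrite T1, T2, T3, !norm_scal_unit in HO by (assumption || lra).
  pose proof (dot_le_norm u1 (minus A1 O) Hu1) as L1.
  pose proof (dot_le_norm u2 (minus A2 O) Hu2) as L2.
  pose proof (dot_le_norm u3 (minus A3 O) Hu3) as L3.
  (* The three unit vectors add up to zero, so the sum of the projections does
     not depend on the base point. *)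
  assert (Hproj : dot (minus A1 O) u1 + dot (minus A2 O) u2 + dot (minus A3 O) u3
                  = dot (minus A1 T) u1 + dot (minus A2 T) u2 + dot (minus A3 T) u3).
  { unfold u1, u2, u3. plane_coords; field. }
  rewrite T1, T2, T3, !dot_scal_l, !dot_norm, Hu1, Hu2, Hu3 in Hproj.
  assert (Q1 : dot (minus A1 O) u1 = norm (minus A1 O)) by lra.
  assert (Q2 : dot (minus A2 O) u2 = norm (minus A2 O)) by lra.
  apply (dot_eq_norm _ _ Hu1) in Q1. apply (dot_eq_norm _ _ Hu2) in Q2.
  set (k1 := norm (minus A1 O)) in *. set (k2 := norm (minus A2 O)) in *.
  clearbody k1 k2.
  (* Both rays lead to [O]; the components along [n] and [e] of the resulting
     equation determine first [k2], then [k1]. *)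
  assert (D : minus A2 A1 = minus (scal k2 u2) (scal k1 u1)).
  { rewrite <- Q1, <- Q2. apply plane_eq; plane_coords; ring. }
  rewrite E2 in D.
  assert (Dn := f_equal (fun X => dot X n) D).
  assert (De := f_equal (fun X => dot X e) D). simpl in Dn, De.
  unfold u1, u2 in Dn, De.
  rewrite dot_minus_l, !dot_plus_l, !dot_scal_l, dot_plus_l, !dot_scal_l,
    (dot_comm n e), Hee, Hen in De.
  rewrite dot_minus_l, !dot_plus_l, !dot_scal_l, dot_plus_l, !dot_scal_l,
    Hnn, Hen in Dn.
  assert (Hq0 : 0 < q) by (unfold q; lra).
  assert (K2 : k2 = 2 * r).
  { apply (Rmult_eq_reg_l q); lra. }
  assert (K1 : k1 = h - r) by lra.
  transitivity (scal (-1) (minus A1 O)).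
  { apply plane_eq; plane_coords; ring. }
  rewrite Q1, K1. unfold u1. apply plane_eq; plane_coords; ring.
Qed.

(** In the right triangle with legs [h], [b] and hypotenuse [a] the half apex angle
    has cosine [h / a]; it is less than 60 degrees iff [a < 2 * h], that is,
    [b ^ 2 < 3 * h ^ 2]. *)
Lemma isosceles_half_apex (A1 A2 A3 e n : plane) (h b a phi : R) :
  0 < h -> 0 < b -> norm e = 1 -> norm n = 1 -> dot e n = 0 ->
  minus A3 A1 = plus (scal h e) (scal b n) ->
  minus (midpoint A2 A3) A1 = scal h e ->
  distance A1 A3 = a -> phi = angle (midpoint A2 A3) A1 A3 ->
  0 < a /\ a * a = h * h + b * b /\ a * sin phi = b /\
  (phi < PI / 3 -> b / sqrt 3 < h).
Proof.
  intros Hh Hb He Hn Hen E3 E4 Ha Hphi.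
  pose proof (dot_unit e He) as Hee. pose proof (dot_unit n Hn) as Hnn.
  assert (Haa : a * a = h * h + b * b).
  { rewrite <- Ha. unfold distance. rewrite <- dot_norm, E3.
    apply dot_orthonormal_comb; assumption. }
  assert (Ha0 : 0 < a).
  { assert (0 <= a) by (rewrite <- Ha; apply norm_ge_0). nra. }
  assert (Hha : h < a) by nra.
  assert (Hphi' : phi = acos (h / a)).
  { rewrite Hphi. unfold angle. f_equal.
    rewrite Ha. unfold distance. rewrite E4, E3.
    rewrite norm_scal_unit by (assumption || lra).
    rewrite dot_scal_l, dot_comm, dot_plus_l, !dot_scal_l, (dot_comm n e), Hee, Hen.
    field. lra. }
  assert (Hrange : -1 <= h / a <= 1).
  { split; [ apply Rle_div_r | apply Rle_div_l ]; lra. }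
  split; [ exact Ha0 | ]. split; [ exact Haa | ]. split.
  - rewrite Hphi', sin_acos by exact Hrange.
    replace (1 - (h / a)²) with ((b / a) * (b / a)).
    + rewrite sqrt_square; [ field; lra | ].
      left; apply Rdiv_lt_0_compat; assumption.
    + unfold Rsqr. replace (b / a * (b / a)) with (b * b / (a * a)) by (field; lra).
      replace (b * b) with (a * a - h * h) by lra. field. lra.
  - intros Hlt.
    assert (Hcos : 1 / 2 < h / a).
    { rewrite <- cos_PI3, <- (cos_acos (h / a)) by exact Hrange.
      rewrite <- Hphi'. pose proof PI_RGT_0.
      pose proof (acos_bound (h / a)) as B. rewrite <- Hphi' in B.
      apply cos_decreasing_1; lra. }
    apply (Rmult_lt_compat_r a) in Hcos; [ | exact Ha0 ].
    replace (h / a * a) with h in Hcos by (field; lra).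
    assert (H3 : 0 < sqrt 3) by (apply sqrt_lt_R0; lra).
    assert (S3 : sqrt 3 * sqrt 3 = 3) by (apply sqrt_sqrt; lra).
    apply Rlt_div_l; [ exact H3 | ].
    assert (b * b < (h * sqrt 3) * (h * sqrt 3)).
    { replace (h * sqrt 3 * (h * sqrt 3)) with (h * h * (sqrt 3 * sqrt 3)) by ring.
      rewrite S3. nra. }
    assert (0 < h * sqrt 3) by (apply Rmult_lt_0_compat; assumption). nra.
Qed.

(** * Rectilinear motion from rest *)

Lemma at_right_0_intro (P : R -> Prop) (d : R) :
  0 < d -> (forall t, 0 < t < d -> P t) -> at_right 0 P.
Proof.
  intros Hd H. exists (mkposreal d Hd). intros y Hy Hy0.
  apply H. split; [ assumption | ].
  change (Rabs (y - 0) < d) in Hy. apply Rabs_def2 in Hy. lra.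
Qed.

Lemma filterlim_lincomb (F : (R -> Prop) -> Prop) {HF : Filter F}
  (f g : R -> R) (j k l m : R) :
  filterlim f F (locally l) -> filterlim g F (locally m) ->
  filterlim (fun t => j * f t + k * g t) F (locally (j * l + k * m)).
Proof.
  intros Hf Hg.
  assert (Hscal : forall (c : R) (u : R -> R) (p : R), filterlim u F (locally p) ->
            filterlim (fun t => c * u t) F (locally (c * p))).
  { intros c u p Hu.
    exact (filterlim_comp _ _ _ u (fun y => c * y) F _ _ Hu
             (filterlim_scal_r (K := R_AbsRing) (V := R_NormedModule) c p)). }
  apply (filterlim_comp_2 (G := locally (j * l)) (H := locally (k * m))
           (fun t => j * f t) (fun t => k * g t) plus).
  - apply Hscal, Hf.
  - apply Hscal, Hg.
  - exact (filterlim_plus (K := R_AbsRing) (V := R_NormedModule) (j * l) (k * m)).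
Qed.

Lemma filterlim_product (F : (R -> Prop) -> Prop) {HF : Filter F}
  (f g : R -> R) (l m : R) :
  filterlim f F (locally l) -> filterlim g F (locally m) ->
  filterlim (fun t => f t * g t) F (locally (l * m)).
Proof.
  intros Hf Hg.
  exact (filterlim_comp_2 f g Rmult Hf Hg (filterlim_mult (K := R_AbsRing) l m)).
Qed.

Lemma mean_value (f f' : R -> R) (T : R) :
  (forall t, 0 < t <= T -> is_derive f t (f' t)) ->
  forall r t, 0 < r < t -> t <= T ->
  exists c, r < c < t /\ f t - f r = f' c * (t - r).
Proof.
  intros Hd r t Hr Ht.
  destruct (MVT_cor2 f f' r t) as [c [E Hc]]; [ lra | | exists c; auto ].
  intros c Hc. apply is_derive_Reals, Hd. lra.
Qed.

Lemma increasing_above_limit (f : R -> R) (l T : R) :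
  (forall r t, 0 < r < t -> t <= T -> f r < f t) ->
  filterlim f (at_right 0) (locally l) ->
  forall t, 0 < t <= T -> l < f t.
Proof.
  intros Hinc Hl t Ht.
  assert (H : Rbar_le l (f (t / 2))).
  { apply (filterlim_le (F := at_right 0) f (fun _ => f (t / 2))).
    - apply (at_right_0_intro _ (t / 2)); [ lra | ].
      intros r Hr. left. apply Hinc; lra.
    - exact Hl.
    - apply filterlim_const. }
  simpl in H. apply (Rle_lt_trans _ _ _ H). apply Hinc; lra.
Qed.

(** The function [g] is the acceleration as a function of the position, assumed
    only where [0 < s t].  Positivity of the acceleration before the passage
    through [d] is what keeps [s] in that region: it makes [w] increasing, so [s]
    is convex and [s t / t] and [w t] are comparable; hence [w] tends to [0] at
    time [0], [w] and then [s] are positive, and the energy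
    [w ^ 2 / 2 - G s] is constant with limit [- G 0] at time [0]. *)
Lemma speed_of_rectilinear_motion_from_rest
  (s w acc g G : R -> R) (d t0 : R) :
  0 < t0 ->
  (forall t, 0 < t -> is_derive s t (w t)) ->
  (forall t, 0 < t -> is_derive w t (acc t)) ->
  filterlim (fun t => s t / t) (at_right 0) (locally 0) ->
  s t0 = d ->
  0 < d -> (forall t, 0 < t < t0 -> s t <> d) ->
  (forall t, 0 < t -> s t < d -> 0 < acc t) ->
  (forall t, 0 < t -> 0 < s t -> acc t = g (s t)) ->
  (forall y, 0 < y -> is_derive G y (g y)) ->
  continuous G 0 ->
  0 < s t0 /\ w t0 = sqrt (2 * (G d - G 0)).
Proof.
  intros Ht0 Hs Hw Hrest Hd Hd0 Hfirst Hpos Hg HG HG0.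
  pose proof (fun t (H : 0 < t <= t0) => Hs t (proj1 H)) as Hs'.
  pose proof (fun t (H : 0 < t <= t0) => Hw t (proj1 H)) as Hw'.
  assert (Hid : filterlim (fun t : R => t) (at_right 0) (locally 0)).
  { intros Q HQ. exact (filter_le_within (F := locally 0) _ Q HQ). }
  assert (Hs0 : filterlim s (at_right 0) (locally 0)).
  { apply (filterlim_ext_loc (fun t => (s t / t) * t)).
    { apply (at_right_0_intro _ 1); [ lra | ]. intros t Ht. field. lra. }
    replace 0 with (0 * 0) at 2 by ring.
    exact (filterlim_product _ _ (fun t => t) _ _ Hrest Hid). }
  assert (Hbefore : forall t, 0 < t < t0 -> s t < d).
  { intros t Ht. destruct (Rlt_or_le (s t) d) as [ | Hge]; [ assumption | exfalso ].
    destruct (Hs0 _ (open_lt d 0 Hd0)) as [eps Heps].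
    set (r := Rmin eps t / 2).
    assert (Hr : 0 < r < t /\ r < eps).
    { pose proof (Rmin_l eps t). pose proof (Rmin_r eps t).
      pose proof (Rmin_pos eps t (cond_pos eps) (proj1 Ht)). unfold r. lra. }
    assert (Hsr : s r < d).
    { apply Heps; [ | lra ]. change (Rabs (r - 0) < eps). apply Rabs_def1; lra. }
    destruct (f_interv_is_interv s r t d) as [c [Hc Ec]]; [ lra | lra | | ].
    - intros c Hc. apply continuity_pt_filterlim.
      apply (ex_derive_continuous s). exists (w c). apply Hs. lra.
    - apply (Hfirst c); [ lra | exact Ec ]. }
  assert (Winc : forall r t, 0 < r < t -> t <= t0 -> w r < w t).
  { intros r t Hr Ht. destruct (mean_value w acc t0 Hw' r t Hr Ht) as [c [Hc E]].
    assert (0 < acc c) by (apply Hpos; [ lra | apply Hbefore; lra ]). nra. }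
  (* By convexity the slope of a chord lies between the velocities at its ends. *)
  assert (Hchord : forall r t, 0 < r < t -> t <= t0 ->
            w r * (t - r) <= s t - s r <= w t * (t - r)).
  { intros r t Hr Ht. destruct (mean_value s w t0 Hs' r t Hr Ht) as [c [Hc E]].
    assert (w r < w c) by (apply Winc; lra).
    assert (w c < w t) by (apply Winc; lra). rewrite E. split; nra. }
  (* The chord from time [0], obtained by letting [r] tend to [0], as [s] is
     differentiable only at positive times. *)
  assert (Hlow : forall t, 0 < t <= t0 -> s t / t <= w t).
  { intros t Ht.
    assert (H : Rbar_le (s t - w t * t) (- w t * 0 + 1 * 0)).
    { apply (filterlim_le (F := at_right 0)
               (fun r => s t - w t * t) (fun r => - w t * r + 1 * s r)).
      - apply (at_right_0_intro _ t); [ lra | ].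
        intros r Hr. destruct (Hchord r t); lra.
      - apply filterlim_const.
      - exact (filterlim_lincomb _ (fun r => r) s _ _ _ _ Hid Hs0). }
    simpl in H. apply Rle_div_l; lra. }
  (* The chord from [t] to [2 * t] bounds [w t] from above, by a quantity that
     tends to [2 * 0 - 0]. *)
  assert (Hdouble : filterlim (fun t => s (2 * t) / (2 * t)) (at_right 0) (locally 0)).
  { apply (filterlim_comp _ _ _ (fun t => 2 * t) (fun t => s t / t) _ (at_right 0));
      [ | exact Hrest ].
    intros Q [eps HQ]. apply (at_right_0_intro _ (eps / 2)).
    - destruct eps as [eps Heps]; simpl; lra.
    - intros t Ht. apply HQ; [ | lra ].
      change (Rabs (2 * t - 0) < eps). apply Rabs_def1; lra. }
  assert (Hw0 : filterlim w (at_right 0) (locally 0)).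
  { apply (filterlim_le_le (fun t => s t / t) w
             (fun t => 2 * (s (2 * t) / (2 * t)) + -1 * (s t / t)) 0).
    - apply (at_right_0_intro _ (t0 / 2)); [ lra | ].
      intros t Ht. split; [ apply Hlow; lra | ].
      destruct (Hchord t (2 * t)) as [H _]; try lra.
      replace (2 * (s (2 * t) / (2 * t)) + -1 * (s t / t))
        with ((s (2 * t) - s t) / t) by (field; lra).
      apply Rle_div_r; lra.
    - exact Hrest.
    - pose proof (filterlim_lincomb _ _ _ 2 (-1) _ _ Hdouble Hrest) as L.
      replace (2 * 0 + -1 * 0) with 0 in L by ring. exact L. }
  assert (Wpos := increasing_above_limit w 0 t0 Winc Hw0).
  assert (Sinc : forall r t, 0 < r < t -> t <= t0 -> s r < s t).
  { intros r t Hr Ht. destruct (Hchord r t Hr Ht) as [H _].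
    assert (0 < w r) by (apply Wpos; lra). nra. }
  assert (Spos := increasing_above_limit s 0 t0 Sinc Hs0).
  split; [ apply Spos; lra | ].
  set (E := fun t => 1 / 2 * (w t * w t) + -1 * G (s t)).
  assert (HE : forall t, 0 < t <= t0 -> is_derive E t 0).
  { intros t Ht.
    assert (D1 : is_derive (fun u => w u * w u) t (acc t * w t + w t * acc t)).
    { apply (is_derive_mult w w t); [ apply Hw'; exact Ht .. | intros; apply Rmult_comm ]. }
    assert (D2 : is_derive (fun u => G (s u)) t (w t * g (s t))).
    { apply (is_derive_comp G s t); [ apply HG, Spos, Ht | apply Hs'; exact Ht ]. }
    rewrite <- (Hg t) in D2 by (lra || apply Spos, Ht).
    replace 0 with (1 / 2 * (acc t * w t + w t * acc t) + -1 * (w t * acc t)) by field.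
    exact (is_derive_plus _ _ t _ _ (is_derive_scal _ t (1 / 2) _ D1)
             (is_derive_scal _ t (-1) _ D2)). }
  assert (HEconst : forall t, 0 < t <= t0 -> E t = E t0).
  { intros t [Ht [Ht' | ->]]; [ | reflexivity ].
    destruct (mean_value E (fun _ => 0) t0 HE t t0) as [c [_ H]]; lra. }
  assert (HElim : filterlim E (at_right 0) (locally (1 / 2 * (0 * 0) + -1 * G 0))).
  { apply filterlim_lincomb; [ apply _ | apply filterlim_product; [ apply _ | exact Hw0 .. ] | ].
    exact (filterlim_comp _ _ _ s G _ _ _ Hs0 HG0). }
  assert (HE0 : E t0 = 1 / 2 * (0 * 0) + -1 * G 0).
  { apply (filterlim_locally_unique (F := at_right 0) (K := R_AbsRing) (V := R_NormedModule) E).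
    - apply (filterlim_ext_loc (fun _ => E t0)); [ | apply filterlim_const ].
      apply (at_right_0_intro _ t0); [ lra | ].
      intros t Ht. symmetry; apply HEconst; lra.
    - exact HElim. }
  unfold E in HE0. rewrite Hd in HE0.
  replace (2 * (G d - G 0)) with (w t0 * w t0) by lra.
  symmetry; apply sqrt_square. left; apply Wpos; lra.
Qed.

(** * The force along the axis *)

(** The vector from [S] to [A] is the force rescaled to length [norm (minus A S)].
    Multiplying the lengths out covers the case [S = A] as well. *)
Lemma pull_component (w : R) (A S F e : plane) :
  pulls_towards w A S F -> w * dot (minus A S) e = norm (minus A S) * dot F e.
Proof.
  intros [HF [k [Hk E]]].
  assert (Hn : norm (minus A S) = k * w).
  { apply norm_of_dot.
    - apply Rmult_le_pos; [ assumption | rewrite <- HF; apply norm_ge_0 ].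
    - rewrite E, dot_scal_l, dot_comm, dot_scal_l, dot_norm, HF. ring. }
  rewrite Hn, E, dot_scal_l. ring.
Qed.

Lemma squared_distance_gt_0 (h b y : R) : 0 < b -> 0 < (h - y) * (h - y) + b * b.
Proof.
  intros Hb. apply Rplus_le_lt_0_compat.
  - apply Rle_0_sqr.
  - apply Rmult_lt_0_compat; assumption.
Qed.

(** The quotient is twice the cosine of the angle under which [A3] is seen from the
    point at distance [y] from [A1] on the height; the string through [A1]
    contributes [- 1] when [0 < y]. *)
Definition axial_force (h b y : R) : R :=
  2 * (h - y) / sqrt ((h - y) * (h - y) + b * b) - 1.

(** Minus the total length of the three strings above the board, for [0 <= y]. *)
Definition axial_work (h b y : R) : R :=
  - 2 * sqrt ((h - y) * (h - y) + b * b) - y.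

Lemma is_derive_axial_work (h b y : R) :
  0 < b -> is_derive (axial_work h b) y (axial_force h b y).
Proof.
  intros Hb. unfold axial_work, axial_force.
  assert (Hroot := squared_distance_gt_0 h b y Hb).
  auto_derive.
  - exact Hroot.
  - pose proof (sqrt_lt_R0 _ Hroot).
    change (h + - y) with (h - y).
    set (r := sqrt _) in *. clearbody r. field. lra.
Qed.

(** Only the string through [A1] may pull in an unexpected direction, namely when
    [y <= 0]; its component along [e] is at least [- 1] in all cases, whence the
    inequality. *)
Lemma axial_acceleration (m h b y : R) (A1 A2 A3 S F1 F2 F3 acc e n : plane) :
  0 < b -> norm e = 1 -> norm n = 1 -> dot e n = 0 ->
  minus A2 A1 = plus (scal h e) (scal (- b) n) ->
  minus A3 A1 = plus (scal h e) (scal b n) ->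
  minus S A1 = scal y e ->
  pulls_towards 1 A1 S F1 -> pulls_towards 1 A2 S F2 -> pulls_towards 1 A3 S F3 ->
  scal m acc = plus (plus F1 F2) F3 ->
  axial_force h b y <= m * dot acc e /\
  (0 < y -> m * dot acc e = axial_force h b y).
Proof.
  intros Hb He Hn Hen E2 E3 HS P1 P2 P3 N.
  pose proof (dot_unit e He) as Hee. pose proof (dot_unit n Hn) as Hnn.
  assert (M2 : minus A2 S = plus (scal (h - y) e) (scal (- b) n)).
  { transitivity (minus (minus A2 A1) (minus S A1)).
    - apply plane_eq; plane_coords; ring.
    - rewrite E2, HS. apply plane_eq; plane_coords; ring. }
  assert (M3 : minus A3 S = plus (scal (h - y) e) (scal b n)).
  { transitivity (minus (minus A3 A1) (minus S A1)).
    - apply plane_eq; plane_coords; ring.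
    - rewrite E3, HS. apply plane_eq; plane_coords; ring. }
  assert (M1 : minus A1 S = scal (- y) e).
  { transitivity (scal (-1) (minus S A1)).
    - apply plane_eq; plane_coords; ring.
    - rewrite HS. apply plane_eq; plane_coords; ring. }
  set (rho := sqrt ((h - y) * (h - y) + b * b)).
  assert (Hrho : 0 < rho) by (apply sqrt_lt_R0, squared_distance_gt_0, Hb).
  assert (N2 : norm (minus A2 S) = rho).
  { rewrite norm_dot, M2, dot_orthonormal_comb by assumption.
    unfold rho. f_equal. ring. }
  assert (N3 : norm (minus A3 S) = rho).
  { rewrite norm_dot, M3, dot_orthonormal_comb by assumption. reflexivity. }
  pose proof (pull_component _ _ _ _ e P1) as C1.
  pose proof (pull_component _ _ _ _ e P2) as C2.
  pose proof (pull_component _ _ _ _ e P3) as C3.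
  rewrite N2, M2, dot_plus_l, !dot_scal_l, (dot_comm n e), Hee, Hen in C2.
  rewrite N3, M3, dot_plus_l, !dot_scal_l, (dot_comm n e), Hee, Hen in C3.
  assert (K2 : dot F2 e = (h - y) / rho).
  { apply (Rmult_eq_reg_l rho); [ rewrite <- C2; field | ]; lra. }
  assert (K3 : dot F3 e = (h - y) / rho).
  { apply (Rmult_eq_reg_l rho); [ rewrite <- C3; field | ]; lra. }
  apply (f_equal (fun X => dot X e)) in N. simpl in N.
  rewrite dot_scal_l, !dot_plus_l, K2, K3 in N.
  rewrite N. unfold axial_force. fold rho. split.
  - pose proof (dot_le_norm e (scal (-1) F1) He) as L.
    rewrite dot_scal_l in L.
    replace (norm (scal (-1) F1)) with 1 in L; [ lra | symmetry ].
    destruct P1 as [U1 _]. apply norm_of_dot; [ lra | ].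
    rewrite dot_scal_l, dot_comm, dot_scal_l, dot_norm, U1. ring.
  - intros Hpos.
    assert (N1 : norm (minus A1 S) = y).
    { apply norm_of_dot; [ lra | ].
      rewrite M1, dot_scal_l, dot_comm, dot_scal_l, Hee. ring. }
    rewrite N1, M1, dot_scal_l, Hee in C1.
    assert (dot F1 e = -1) as -> by (apply (Rmult_eq_reg_l y); lra).
    field. lra.
Qed.

(** At the Fermat-Torricelli point the angle is 60 degrees, and before it the
    cosine exceeds [1 / 2]: with [r = b / sqrt 3] and [r < u] this reads
    [u ^ 2 + 3 * r ^ 2 < (2 * u) ^ 2]. *)
Lemma axial_force_gt_0 (h b y : R) :
  0 < b -> y < h - b / sqrt 3 ->
  0 < axial_force h b y.
Proof.
  intros Hb Hy.
  assert (H3 : 0 < sqrt 3) by (apply sqrt_lt_R0; lra).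
  assert (S3 : sqrt 3 * sqrt 3 = 3) by (apply sqrt_sqrt; lra).
  assert (Hr : 0 < b / sqrt 3) by (apply Rdiv_lt_0_compat; assumption).
  set (r := b / sqrt 3) in *.
  assert (E : b * b = 3 * (r * r)).
  { rewrite <- S3. unfold r. field. lra. }
  set (u := h - y). assert (Hu : r < u) by (unfold u; lra).
  assert (Hpos : 0 < u * u + b * b) by nra.
  unfold axial_force. fold u. apply Rlt_0_minus.
  apply Rlt_div_r; [ apply sqrt_lt_R0, Hpos | ].
  rewrite Rmult_1_l.
  rewrite <- (sqrt_square (2 * u)) by lra.
  apply sqrt_lt_1; nra.
Qed.

(** * Speed at the Fermat-Torricelli point *)

Theorem corollary3
  (A1 A2 A3 O : plane) (a phi0 : R)
  (Htriangle : is_triangle A1 A2 A3)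
  (H12 : distance A1 A2 = a) (H13 : distance A1 A3 = a)
  (Hphi0 : phi0 = angle (midpoint A2 A3) A1 A3)
  (Hphi0_lt : phi0 < PI / 3)
  (HO : fermat_torricelli A1 A2 A3 O)
  (m0 : R) (Hm0 : 0 < m0)
  (P v : R -> plane)
  (Hmotion : knot_motion m0 1 1 1 A1 A2 A3 P v)
  (Hline : forall t : R, 0 <= t -> on_line A1 O (P t))
  (x : R -> R)
  (Hx : forall t : R, 0 <= t -> x t = distance A1 (P t))
  (t0 : R) (Ht0 : first_passage P O t0) :
  is_derive x t0
    (sqrt (2 / m0 * (2 * a - x t0 - 4 * a * sin phi0 / sqrt 3))).
Proof.
  destruct (isosceles_frame A1 A2 A3 Htriangle) as
    (e & n & h & b & Hh & Hb & He & Hn & Hen & E2 & E3 & E4); [ congruence | ].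
  destruct (isosceles_half_apex A1 A2 A3 e n h b a phi0) as
    (Ha & Haa & Hsin & Hapex); try assumption.
  specialize (Hapex Hphi0_lt).
  pose proof (fermat_torricelli_isosceles A1 A2 A3 O e n h b Hb
                (Rlt_le _ _ Hapex) He Hn Hen E2 E3 HO) as EO.
  set (d := h - b / sqrt 3) in *. assert (Hd0 : 0 < d) by (unfold d; lra).
  pose proof (dot_unit e He) as Hee. pose proof (dot_unit n Hn) as Hnn.
  destruct Hmotion as [Hstart Hrest Hvel Hnewton].
  destruct Ht0 as [Ht0 [HPt0 Hfirst]].
  set (s := fun t => dot (minus (P t) A1) e).
  assert (HP : forall t, 0 <= t -> minus (P t) A1 = scal (s t) e).
  { intros t Ht. destruct (Hline t Ht) as [k Hk].
    assert (E : minus (P t) A1 = scal (k * d) e).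
    { rewrite Hk, EO. apply plane_eq; plane_coords; ring. }
    unfold s. rewrite E, dot_scal_l, Hee, Rmult_1_r. reflexivity. }
  assert (HsO : forall t, 0 <= t -> s t = d -> P t = O).
  { intros t Ht E. specialize (HP t Ht). rewrite E, <- EO in HP.
    transitivity (plus A1 (minus (P t) A1)).
    - apply plane_eq; plane_coords; ring.
    - rewrite HP. apply plane_eq; plane_coords; ring. }
  assert (Hst0 : s t0 = d).
  { unfold s. rewrite HPt0, EO, dot_scal_l, Hee. ring. }
  assert (Hs_start : s 0 = 0).
  { unfold s. rewrite Hstart. plane_coords; ring. }
  assert (Ht0pos : 0 < t0).
  { destruct Ht0 as [ | <- ]; [ assumption | lra ]. }
  set (w := fun t => dot (v t) e).
  assert (Hs : forall t, 0 < t -> is_derive s t (w t)).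
  { intros t Ht. apply (is_derive_dot (fun u => minus (P u) A1)).
    unfold w. rewrite <- (minus_zero_r (v t)).
    apply (is_derive_minus (V := plane) P (fun _ => A1)).
    - apply Hvel, Ht.
    - exact (is_derive_const (V := plane) A1 t). }
  assert (Hs_rest : filterlim (fun t => s t / t) (at_right 0) (locally 0)).
  { apply (filterlim_ext_loc (fun t => dot (scal (/ t) (minus (P t) (P 0))) e)).
    - apply (at_right_0_intro _ 1); [ lra | ]. intros t Ht.
      rewrite Hstart, dot_scal_l. unfold s. field. lra.
    - assert (C : continuous (fun X : plane => dot X e) (zero : plane)).
      { apply (filterdiff_continuous (K := R_AbsRing) (U := plane) (V := R_NormedModule)).
        exists (fun X : plane => dot X e).
        apply filterdiff_linear, is_linear_dot. }
      unfold continuous in C.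
      replace (dot zero e) with 0 in C by (unfold dot; simpl; unfold zero; simpl; ring).
      exact (filterlim_comp _ _ _ _ _ _ _ _ Hrest C). }
  set (g := fun y => axial_force h b y / m0).
  set (G := fun y => axial_work h b y / m0).
  assert (HG : forall y, is_derive G y (g y)).
  { intros y. unfold G, g, Rdiv.
    apply (is_derive_ext (fun y => / m0 * axial_work h b y)); [ intros; apply Rmult_comm | ].
    rewrite Rmult_comm. apply is_derive_scal, is_derive_axial_work, Hb. }
  assert (Hforce : forall t, 0 < t ->
            exists acc : R, is_derive w t acc /\ g (s t) <= acc /\ (0 < s t -> acc = g (s t))).
  { intros t Ht. destruct (Hnewton t Ht) as (F1 & F2 & F3 & acc & P1 & P2 & P3 & Dv & N).
    exists (dot acc e). split; [ apply is_derive_dot, Dv | ].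
    destruct (axial_acceleration m0 h b (s t) A1 A2 A3 (P t) F1 F2 F3 acc e n)
      as [Hge Heq]; try assumption.
    { apply HP; lra. }
    split.
    - apply Rle_div_l; lra.
    - intros Hpos. unfold g. rewrite <- (Heq Hpos). field. lra. }
  assert (Hw : forall t, 0 < t -> is_derive w t (Derive w t)).
  { intros t Ht. destruct (Hforce t Ht) as [acc [D _]].
    apply Derive_correct. exists acc. exact D. }
  assert (Hnot : forall t, 0 < t < t0 -> s t <> d).
  { intros t Ht E. apply (Hfirst t); [ lra | apply HsO; [ lra | exact E ] ]. }
  destruct (speed_of_rectilinear_motion_from_rest s w (Derive w) g G d t0)
    as [Hspos Hspeed]; try assumption.
  { intros t Ht Hlt. destruct (Hforce t Ht) as [acc [D [Hge _]]].
    rewrite (is_derive_unique _ _ _ D).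
    apply (Rlt_le_trans _ (g (s t))); [ | exact Hge ].
    apply Rdiv_lt_0_compat; [ apply axial_force_gt_0; assumption | assumption ]. }
  { intros t Ht Hpos. destruct (Hforce t Ht) as [acc [D [_ E]]].
    rewrite (is_derive_unique _ _ _ D). apply E, Hpos. }
  { intros y _. apply HG. }
  { apply (ex_derive_continuous G). exists (g 0). apply HG. }
  assert (Hxs : forall t, 0 < t -> 0 < s t -> x t = s t).
  { intros t Ht Hpos. rewrite Hx by lra. unfold distance.
    rewrite HP by lra. apply norm_scal_unit; [ lra | exact He ]. }
  replace (2 / m0 * (2 * a - x t0 - 4 * a * sin phi0 / sqrt 3))
    with (2 * (G d - G 0)).
  - rewrite <- Hspeed.
    apply (is_derive_ext_loc s); [ | apply Hs, Ht0pos ].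
    (* [x] is the distance to [A1], hence equal to [s] only where [s] is positive. *)
    assert (Hloc : locally t0 (fun t => 0 < t /\ 0 < s t)).
    { apply filter_and; [ exact (open_gt 0 t0 Ht0pos) | ].
      apply (ex_derive_continuous s t0 (ex_intro _ _ (Hs t0 Ht0pos))).
      exact (open_gt 0 (s t0) Hspos). }
    apply (filter_imp (F := locally t0) _ _
             (fun t H => eq_sym (Hxs t (proj1 H) (proj2 H))) Hloc).
  - rewrite (Hxs t0 Ht0pos Hspos), Hst0. unfold G, axial_work.
    assert (H3 : 0 < sqrt 3) by (apply sqrt_lt_R0; lra).
    assert (S3 : sqrt 3 * sqrt 3 = 3) by (apply sqrt_sqrt; lra).
    replace (sqrt ((h - 0) * (h - 0) + b * b)) with a.
    + replace (sqrt ((h - d) * (h - d) + b * b)) with (2 * b / sqrt 3).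
      * rewrite <- Hsin. field. lra.
      * rewrite <- (sqrt_square (2 * b / sqrt 3)).
        -- f_equal. replace (h - d) with (b / sqrt 3) by (unfold d; ring).
           replace (b * b) with (b * b * 3 / (sqrt 3 * sqrt 3)) by (rewrite S3; field).
           field. lra.
        -- left. apply Rdiv_lt_0_compat; lra.
    + replace ((h - 0) * (h - 0) + b * b) with (a * a) by (rewrite Haa; ring).
      rewrite sqrt_square; lra.
Qed.
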